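(* Let $l\ge 1$, $d=2l$, and let $c_{i1},c_{i2}\in\mathbb{Z}$ ($i=1,\dots,l$). Let $\mathcal{M}_{\mathcal{A}}\subset\mathbb{N}^d$ be the associated monoid (defined in the context) and $I_{\mathcal{A}}=\langle \mathbf{x}^\mu-\mathbf{x}^{\overline{\mu}}\mid\mu\in\mathcal{M}_{\mathcal{A}}\rangle\subset R=\mathbb{C}[x_1,\dots,x_d]$. Let $G$ be a reduced Gröbner basis of $I_{\mathcal{A}}$ with respect to some term ordering on $R$. Then: 1. The set $$\mathcal{H}=\{\mu,\overline{\mu}\;\mid\;\mathbf{x}^\mu-\mathbf{x}^{\overline{\mu}}\in G\}\;\cup\;\{\mathbf{e}_i+\mathbf{e}_j\;\mid\; j=d-i+1;\ i=1,\dots,l\},$$ where $\mathbf{e}_i=(0,\dots,0,1,0,\dots,0)$ is the $i$th basis vector, is a Hilbert basis of $\mathcal{M}_{\mathcal{A}}$. (Note that $\mathbf{e}_i+\mathbf{e}_{d-i+1}\in\mathcal{M}_{\mathcal{A}}$ for all $i$.) 2. $I_{\mathcal{A}}=\langle\mathbf{x}^\mu-\mathbf{x}^{\overline{\mu}}\mid\mu\in\mathcal{H}\rangle$.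
   Context: $\mathbb{N}$ denotes the nonnegative integers. $\mathcal{A}$ is the $2\times 2l$ integer matrix $$\mathcal{A}=\begin{pmatrix}c_{11}&c_{21}&\cdots&c_{l1}&c_{l2}&\cdots&c_{22}&c_{12}\\ c_{12}&c_{22}&\cdots&c_{l2}&c_{l1}&\cdots&c_{21}&c_{11}\end{pmatrix},$$ and $\mathcal{M}_{\mathcal{A}}=\{\nu\in\mathbb{N}^{2l}\mid \mathcal{A}\nu^t=(k,k)^t\text{ for some }k\in\mathbb{N}\}$, an Abelian submonoid of $\mathbb{N}^{2l}$. For $\mu=(\mu_1,\dots,\mu_{2l})$ put $\overline{\mu}=(\mu_{2l},\dots,\mu_1)$ and $\mathbf{x}^\mu=x_1^{\mu_1}\cdots x_d^{\mu_d}$. A Hilbert basis of a monoid is a finite minimal generating set.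
   Formalization: The noted fact e_i+e_{d-i+1} ∈ M_A for all i is assumed (it fails for c_{i1}+c_{i2}<0, and with it part 1); minimality in ''Hilbert basis'' is claimed only if c_{i1}≠c_{i2} for all i (else e_i, e_{d-i+1} and their sum all lie in H). Finiteness, generation and part 2 need no such restriction. *)

(* Defs.v *)
(* MathComp with multinomials.  Subsets are predicates [T -> Prop], and a
   vector of N^n is a multinomial ['X_{1..n}], which is both an exponent vector
   and an element of the additive monoid N^n.  The dimension 2l is written
   [l + l], and the 1-based index i becomes i - 1. *)
From mathcomp Require Import all_boot all_order all_algebra.
From mathcomp Require Import reals complex mpoly.

Set Implicit Arguments.
Unset Strict Implicit.
Unset Printing Implicit Defensive.

Import GRing.Theory.
Local Open Scope ring_scope.

Section Monoids.
Variable n : nat.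
Implicit Types M S : 'X_{1..n} -> Prop.

Definition finite_subset S : Prop :=
  exists s : seq 'X_{1..n}, forall m, S m -> m \in s.

(* The empty sum is allowed: a monoid always contains 0. *)
Definition generates S M : Prop :=
  forall m, M m <->
    exists s : seq 'X_{1..n},
      (forall x, x \in s -> S x) /\ m = (\sum_(x <- s) x)%MM.

(* A finite generating set no proper subset of which generates. *)
Definition hilbert_basis M S : Prop :=
  [/\ finite_subset S,
      generates S M
    & forall S', (forall m, S' m -> S m) -> generates S' M ->
        forall m, S m -> S' m].

Definition mrev (m : 'X_{1..n}) : 'X_{1..n} := [multinom m (rev_ord i) | i < n].

End Monoids.

Definition ideal_gen (P : comNzRingType) (S : P -> Prop) (p : P) : Prop :=
  exists s : seq (P * P),
    (forall q, q \in s -> S q.2) /\ p = \sum_(q <- s) q.1 * q.2.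

Section Groebner.
Variables (K : fieldType) (n : nat).
Implicit Types (le : rel 'X_{1..n}) (p t : {mpoly K[n]}).
Implicit Types (I : {mpoly K[n]} -> Prop) (G : seq {mpoly K[n]}).

(* Mathcomp's [mlead] is tied to degrevlex, so leading terms are redefined for
   an arbitrary term ordering [le], read as "smaller than or equal to". *)
Definition term_order le : Prop :=
  [/\ [/\ reflexive le, antisymmetric le, transitive le & total le],
      forall m1 m2 m, le m1 m2 -> le (m1 + m)%MM (m2 + m)%MM
    & forall Q : 'X_{1..n} -> Prop, (exists m, Q m) ->
        exists2 m, Q m & forall m', Q m' -> le m m'].

Definition lead_monomial le p (m : 'X_{1..n}) : Prop :=
  m \in msupp p /\ forall m', m' \in msupp p -> le m' m.

(* The leading terms of the nonzero elements of [S]; 0 has no leading term. *)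
Definition lead_terms le (S : {mpoly K[n]} -> Prop) t : Prop :=
  exists p m, [/\ S p, lead_monomial le p m & t = p@_m *: 'X_[m]].

Definition groebner_basis le I G : Prop :=
  (forall g, g \in G -> I g) /\
  (forall p, ideal_gen (lead_terms le I) p <->
             ideal_gen (lead_terms le (fun g => g \in G)) p).

Definition reduced_groebner_basis le I G : Prop :=
  [/\ groebner_basis le I G,
      forall g, g \in G -> exists2 m, lead_monomial le g m & g@_m = 1
    & forall g m, g \in G -> m \in msupp g ->
        ~ ideal_gen (lead_terms le (fun h => h \in G /\ h <> g)) 'X_[m]].

End Groebner.

Section Construction.
Variables (l : nat) (c : 'M[int]_(l, 2)).

(* Row i of [c] is (c_{i1}, c_{i2}).  The right half of the matrix is the left
   half with both the columns and the two rows reversed. *)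
Definition matA : 'M[int]_(2, l + l) :=
  \matrix_(r < 2, j < l + l)
    match split j with
    | inl i => c i r
    | inr i => c (rev_ord i) (rev_ord r)
    end.

Definition monA (nu : 'X_{1..l + l}) : Prop :=
  exists k : nat, matA *m \col_j (nu j)%:Z = const_mx k%:Z.

(* e_i + e_(d-i+1), for i = 1, ..., l. *)
Definition pair_vec (i : 'I_l) : 'X_{1..l + l} :=
  (U_(lshift l i) + U_(rev_ord (lshift l i)))%MM.

Variable K : fieldType.

Definition binom (mu : 'X_{1..l + l}) : {mpoly K[l + l]} :=
  'X_[mu] - 'X_[mrev mu].

Definition binom_ideal (S : 'X_{1..l + l} -> Prop) : {mpoly K[l + l]} -> Prop :=
  ideal_gen (fun p => exists2 mu, S mu & p = binom mu).

Definition setH (G : seq {mpoly K[l + l]}) (nu : 'X_{1..l + l}) : Prop :=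
  (exists2 mu, binom mu \in G & nu = mu \/ nu = mrev mu) \/
  (exists i : 'I_l, nu = pair_vec i).

End Construction.

(* Main.v *)
Require Import Defs.
From mathcomp Require Import all_boot all_order all_algebra.
From mathcomp Require Import reals complex mpoly ssrcomplements.
From mathcomp Require Import zify.

Set Implicit Arguments.
Unset Strict Implicit.
Unset Printing Implicit Defensive.

Import GRing.Theory Num.Theory.
Local Open Scope ring_scope.

(** The two rows of the matrix are exchanged by reversing the columns, so the
    two entries of its product with [u] differ by a weight of [u] that reversal
    negates. Since the vectors [e_i + e_(d-i+1)] are in the monoid, the sum of
    the two entries is nonnegative for every [u]; hence the monoid is exactly
    the set of vectors of weight 0 ([monA_weight]). In particular it is stable
    under reversal, and the difference of two comparable elements is again an
    element.

    The ideal is a lattice ideal. Send [u] to the pair of its symmetrization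
    [u + mrev u] and its weight. Then [X^u - X^v] is in the ideal whenever [u]
    and [v] have the same image ([binom_ideal_diff]), and the coefficients of an
    element of the ideal add up to 0 over each fibre ([binom_ideal_fiber_sum]).
    For an ideal with these two properties, every element [g] of a reduced
    Groebner basis is a difference of two monomials of one fibre
    ([reduced_binomial]): two monomials of [g] in one fibre, both different from
    the leading one, would give an element of the ideal whose leading monomial
    occurs in the tail of [g], which reducedness excludes. Cancelling common
    factors, again by reducedness, [g] is the binomial of a vector [a] of the
    monoid such that [a] and [mrev a] have disjoint supports
    ([groebner_binom]).

    The set H generates the monoid. Let [u] be a nonzero element. If its support
    meets that of its reversal, some [e_i + e_(d-i+1)] lies below [u]. If not,
    [u] differs from [mrev u], one of the two is the leading monomial of the
    binomial of [u], and so some element of H lies below [u] ([setH_dvd]).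
    Subtract it and repeat.

    The set H is minimal because its elements are irreducible, and an
    irreducible element belongs to every generating set
    ([generates_irreducible]). If the exponent [a] of an element of [G] were a
    sum of two nonzero elements of the monoid, the binomial of one summand would
    have a leading monomial that properly divides one of the two monomials of
    that element of [G] ([groebner_irreducible]). The vector [e_i + e_(d-i+1)]
    is irreducible when [e_i] has nonzero weight, that is when the two entries
    of row [i] differ ([pair_vec_irreducible]).

    Generators of the monoid give generators of the ideal, as the binomial of a
    sum is a combination of the binomials of the summands
    ([binom_ideal_generates]). *)

(** * Ideals and term orderings *)

Section IdealGen.
Variable P : comNzRingType.
Implicit Types (S T : P -> Prop) (p q : P).

Lemma ideal_gen_sub S p : S p -> ideal_gen S p.
Proof.
move=> Sp; exists [:: (1, p)]; split=> [q|]; first by rewrite inE => /eqP ->.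
by rewrite big_seq1 mul1r.
Qed.

Lemma ideal_gen0 S : ideal_gen S 0.
Proof. by exists [::]; split=> //; rewrite big_nil. Qed.

Lemma ideal_genD S p q : ideal_gen S p -> ideal_gen S q -> ideal_gen S (p + q).
Proof.
case=> [s [sS ->]] [t [tS ->]]; exists (s ++ t); split; last by rewrite big_cat.
by move=> x; rewrite mem_cat => /orP[/sS|/tS].
Qed.

Lemma ideal_genM S r p : ideal_gen S p -> ideal_gen S (r * p).
Proof.
case=> [s [sS ->]]; exists [seq (r * x.1, x.2) | x <- s]; split.
  by move=> _ /mapP[x /sS Sx ->].
by rewrite big_map mulr_sumr; apply: eq_bigr => x _; rewrite mulrA.
Qed.

Lemma ideal_gen_le S T p :
  (forall q, S q -> ideal_gen T q) -> ideal_gen S p -> ideal_gen T p.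
Proof.
move=> sST [s [sS ->]]; elim: s sS => [|x s IHs] sS.
  by rewrite big_nil; apply: ideal_gen0.
rewrite big_cons; apply: ideal_genD.
  by apply/ideal_genM/sST/sS; rewrite mem_head.
by apply: IHs => q sq; apply: sS; rewrite inE sq orbT.
Qed.

End IdealGen.

Section TermOrder.
Variables (n : nat) (le : rel 'X_{1..n}).
Hypothesis hle : term_order le.

Lemma term_order_anti u v : le u v -> le v u -> u = v.
Proof. by case: hle => [[_ anti _ _] _ _] uv vu; apply: anti; rewrite uv. Qed.

Lemma term_order_total u v : le u v \/ le v u.
Proof. by case: hle => [[_ _ _ tot] _ _]; apply/orP/tot. Qed.

(** A monomial smaller than 1 would have an infinite strictly decreasing
    sequence of powers. *)
Lemma term_order_ge0 m : le 0%MM m.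
Proof.
case: (term_order_total 0%MM m) => // m0.
case: hle => [_ add well].
have [|_ [k ->] min_k] := well (fun u => exists k, u = (m *+ k)%MM).
  by exists 0%MM, 0%N; rewrite mulm0n.
have := min_k (m *+ k.+1)%MM (ex_intro _ _ erefl).
have := add _ _ (m *+ k)%MM m0; rewrite add0m -mulmS => le1 le2.
have e := term_order_anti le2 le1.
have -> : m = 0%MM.
  by apply: (@addIm _ (m *+ k)%MM); rewrite add0m -mulmS.
by case: hle => [[refl _ _ _] _ _].
Qed.

Lemma term_order_dvd u v : (u <= v)%MM -> le u v.
Proof.
move=> uv; rewrite -(submK uv).
by case: hle => [_ add _]; have := add _ _ u (term_order_ge0 (v - u)); rewrite add0m.
Qed.

Lemma term_order_addr u v m : le (u + m)%MM (v + m)%MM -> le u v.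
Proof.
move=> h; case: (term_order_total u v) => // vu.
case: hle => [[refl _ _ _] add _].
by rewrite (addIm (term_order_anti h (add _ _ m vu))).
Qed.

Variable K : fieldType.
Implicit Types (p : {mpoly K[n]}) (S : {mpoly K[n]} -> Prop).

Lemma lead_monomial_uniq p u v :
  lead_monomial le p u -> lead_monomial le p v -> u = v.
Proof. by case=> pu maxu [pv maxv]; apply: term_order_anti; auto. Qed.

Lemma mem_msupp_diff u v m : u != v ->
  (m \in msupp ('X_[u] - 'X_[v] : {mpoly K[n]})) = (m == u) || (m == v).
Proof.
move=> uv; rewrite mcoeff_msupp mcoeffB !mcoeffX ![_ == m]eq_sym.
have [->|mu] := eqVneq m u; first by rewrite (negPf uv) subr0 oner_eq0.
by case: (m == v); rewrite ?subr0 ?eqxx // sub0r oppr_eq0 oner_eq0.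
Qed.

Lemma lead_monomial_diff u v : u != v -> le v u ->
  lead_monomial le ('X_[u] - 'X_[v] : {mpoly K[n]}) u.
Proof.
move=> uv vu; split; first by rewrite mem_msupp_diff // eqxx.
case: hle => [[refl _ _ _] _ _] m; rewrite mem_msupp_diff //.
by case/orP=> /eqP ->.
Qed.

(** A monomial of a sum of multiples of terms is a multiple of one of them, as
    no term is lost but by cancellation. *)
Lemma monomial_in_lead_ideal S m :
  ideal_gen (lead_terms le S) ('X_[m] : {mpoly K[n]}) <->
  exists p u, [/\ S p, lead_monomial le p u & (u <= m)%MM].
Proof.
split=> [[s [sS e]]|[p [u [Sp pu um]]]].
  have [q sq qm] : exists2 q, q \in s & (q.1 * q.2)@_m != 0.
    apply/hasP; apply: contraT => /hasPn no.
    suff : ('X_[m] : {mpoly K[n]})@_m = 0.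
      by rewrite mcoeffX eqxx => /eqP; rewrite oner_eq0.
    rewrite e raddf_sum big_seq big1 // => q sq.
    by have := no _ sq; rewrite negbK => /eqP.
  have [p [u [Sp pu q2]]] := sS _ sq; exists p, u; split=> //.
  move: qm; rewrite q2 -scalerAr mcoeffZ mulf_eq0 negb_or => /andP[_].
  rewrite -mcoeff_msupp (perm_mem (msuppMX _ _)) => /mapP[k _ ->].
  exact: lem_addr.
rewrite -(submK um) mpolyXD.
have nz : p@_u != 0 by rewrite -mcoeff_msupp; case: pu.
rewrite -['X_[u]]scale1r -(mulVf nz) -scalerA -[(_^-1) *: _]mul_mpolyC mulrA.
by apply/ideal_genM/ideal_gen_sub; exists p, u.
Qed.

End TermOrder.

(** * Reduced Groebner bases of ideals graded by the fibres of a map *)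

Section FiberSum.
Variables (K : fieldType) (n : nat) (T : eqType) (Phi : 'X_{1..n} -> T).
Implicit Types (p : {mpoly K[n]}) (t : T).

Definition fiber_sum t p : K := \sum_(m <- msupp p | Phi m == t) p@_m.

Lemma fiber_sumwE t k p : (msize p <= k)%N ->
  fiber_sum t p = \sum_(m : 'X_{1..n < k} | Phi m == t) p@_m.
Proof.
move=> pk; pose I : subFinType _ := 'X_{1..n < k}.
rewrite /fiber_sum big_mkcond (big_mksub I) //=; first last.
- by move=> x /msize_mdeg_lt /leq_trans; apply.
- by rewrite msupp_uniq.
rewrite big_rmcond //= => [|i /memN_msupp_eq0 ->]; last by rewrite if_same.
by rewrite -big_mkcond.
Qed.

Lemma fiber_sumD t : {morph fiber_sum t : p q / p + q}.
Proof.
move=> p q; pose k := maxn (msize (p + q)) (maxn (msize p) (msize q)).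
rewrite !(@fiber_sumwE _ k) ?leq_max ?leqnn ?orbT // -big_split.
by apply: eq_bigr => m _; rewrite mcoeffD.
Qed.

Lemma fiber_sumZX t a u :
  fiber_sum t (a *: 'X_[u]) = if Phi u == t then a else 0.
Proof.
have [->|a0] := eqVneq a 0; last first.
  rewrite /fiber_sum msuppMCX // big_cons big_nil mcoeffZ mcoeffX eqxx mulr1.
  by rewrite addr0.
by rewrite if_same scale0r /fiber_sum msupp0 big_nil.
Qed.

Lemma fiber_sum0 t : fiber_sum t 0 = 0.
Proof. by rewrite /fiber_sum msupp0 big_nil. Qed.

(** The generators have fibre sums 0, and so do their products with monomials
    as soon as translations permute the fibres. *)
Lemma fiber_sum_ideal (S : {mpoly K[n]} -> Prop) t p :
  (forall m u v, Phi u = Phi v -> Phi (m + u)%MM = Phi (m + v)%MM) ->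
  (forall q, S q -> exists u v, Phi u = Phi v /\ q = 'X_[u] - 'X_[v]) ->
  ideal_gen S p -> fiber_sum t p = 0.
Proof.
move=> Phi_add S_bin [s [sS ->]].
rewrite (big_morph _ (fiber_sumD t) (fiber_sum0 t)) big_seq big1 // => q sq.
have [u [v [uv ->]]] := S_bin _ (sS _ sq).
rewrite [q.1]mpolyE mulr_suml (big_morph _ (fiber_sumD t) (fiber_sum0 t)).
rewrite big1 // => m _; rewrite -scalerAl mulrBr -!mpolyXD scalerBr -scaleNr.
rewrite fiber_sumD !fiber_sumZX (Phi_add m _ _ uv).
by case: ifP => _; rewrite ?subrr ?addr0.
Qed.

Lemma fiber_partner p u : (forall t, fiber_sum t p = 0) -> u \in msupp p ->
  exists v, [/\ v \in msupp p, v != u & Phi v = Phi u].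
Proof.
move=> p0 pu.
have /hasP[v pv /andP[vu /eqP Pv]] :
    has (fun v => (v != u) && (Phi v == Phi u)) (msupp p); last by exists v.
apply: contraT => /hasPn no; have := p0 (Phi u).
rewrite /fiber_sum big_mkcond (bigD1_seq u) //= eqxx big_seq_cond big1.
  by rewrite addr0 => /eqP; rewrite mcoeff_eq0 pu.
by move=> v /andP[/no]; rewrite negb_and negbK => /orP[->|/negPf ->].
Qed.

End FiberSum.

Section ReducedBasis.
Variables (K : fieldType) (n : nat) (le : rel 'X_{1..n}).
Hypothesis hle : term_order le.
Variables (I : {mpoly K[n]} -> Prop) (G : seq {mpoly K[n]}).
Hypothesis hG : reduced_groebner_basis le I G.

Lemma groebner_lead_dvd p m : I p -> lead_monomial le p m ->
  exists g a, [/\ g \in G, lead_monomial le g a & (a <= m)%MM].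
Proof.
case: hG => [[_ eqGI] _ _] Ip pm.
apply/monomial_in_lead_ideal/eqGI/monomial_in_lead_ideal; exists p, m.
by split=> //; apply: lepm_refl.
Qed.

(** The leading monomial of some element of [G] divides [m], hence the monomial
    [b] of [g]; reducedness forces that element to be [g] itself. *)
Lemma reduced_lead_min p m g a b : I p -> lead_monomial le p m ->
  g \in G -> lead_monomial le g a -> b \in msupp g -> (m <= b)%MM ->
  (a <= m)%MM.
Proof.
move=> Ip pm Gg ga gb mb; have [h [d [Gh hd dm]]] := groebner_lead_dvd Ip pm.
case: hG => _ _ red; have [e|hg] := eqVneq h g.
  by rewrite e in hd; rewrite (lead_monomial_uniq hle ga hd).
case: (red _ _ Gg gb); apply/monomial_in_lead_ideal.
exists h, d; split=> //; first by split=> //; apply/eqP.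
exact: lepm_trans mb.
Qed.

Variables (T : eqType) (Phi : 'X_{1..n} -> T).
Hypothesis I_diff : forall u v, Phi u = Phi v -> I ('X_[u] - 'X_[v]).
Hypothesis I_sum : forall p t, I p -> fiber_sum Phi t p = 0.

(** Otherwise the difference of the two is in the ideal, so that the larger one
    is divisible by the leading monomial of [g], which is larger still. *)
Lemma reduced_tail_injective g a u v : g \in G -> lead_monomial le g a ->
  u \in msupp g -> v \in msupp g -> u != a -> v != a -> Phi u = Phi v -> u = v.
Proof.
move=> Gg ga; suff main u' v' : u' \in msupp g -> u' != a -> Phi u' = Phi v' ->
    le v' u' -> u' = v'.
  move=> gu gv ua va uv; case: (term_order_total hle u v) => h.
    by apply/esym/main.
  exact: main.
move=> gu ua uv vu; apply/eqP; apply: contraT => neq.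
have := reduced_lead_min (I_diff uv) (lead_monomial_diff hle K neq vu)
  Gg ga gu (lepm_refl _).
move/(term_order_dvd hle) => au; case: ga => _ /(_ _ gu) ua'.
by rewrite (term_order_anti hle ua' au) eqxx in ua.
Qed.

(** Each fibre that meets the support of [g] does so at least twice, as the sum
    of coefficients over it is 0, but at most once off the leading monomial.
    So the support is the leading monomial and one further monomial of its
    fibre. *)
Lemma reduced_binomial g : g \in G -> exists a b,
  [/\ a != b, Phi a = Phi b, g = 'X_[a] - 'X_[b] & lead_monomial le g a].
Proof.
move=> Gg; case: (hG) => [[GI _] monic _]; have [a ga g1] := monic _ Gg.
have g0 t : fiber_sum Phi t g = 0 by apply/I_sum/GI.
have [b [gb ba Pb]] := fiber_partner g0 (proj1 ga).
have supp u : u \in msupp g -> (u == a) || (u == b).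
  move=> gu; case: eqP => //= /eqP ua.
  have [v [gv vu Pv]] := fiber_partner g0 gu.
  have [va|va] := eqVneq v a.
    by apply/eqP/(reduced_tail_injective Gg ga) => //; rewrite Pb -va.
  by rewrite (reduced_tail_injective Gg ga gv gu) ?eqxx in vu.
have psupp : perm_eq (msupp g) [:: a; b].
  apply: uniq_perm; rewrite ?msupp_uniq //= ?inE ?andbT 1?eq_sym // => u.
  rewrite !inE; apply/idP/idP=> [/supp//|/orP[]/eqP-> //]; by case: ga.
exists a, b; split=> //; first by rewrite eq_sym.
have gb1 : g@_b = -1.
  have := g0 (Phi a); rewrite /fiber_sum (perm_big _ psupp) /=.
  rewrite !big_cons big_nil Pb eqxx g1 addr0 addrC.
  by move/eqP; rewrite addr_eq0 => /eqP.
by rewrite [LHS]mpolyE (perm_big _ psupp) /= !big_cons big_nil g1 gb1 addr0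
  scale1r scaleN1r.
Qed.

End ReducedBasis.

(** * The monoid as the kernel of a weight *)

Section Reversal.
Variable n : nat.
Implicit Types u v : 'X_{1..n}.

Lemma mrevE u i : mrev u i = u (rev_ord i).
Proof. exact: mnmE. Qed.

Lemma mrevK : involutive (@mrev n).
Proof. by move=> u; apply/mnmP=> i; rewrite !mrevE rev_ordK. Qed.

Lemma mrevD u v : mrev (u + v) = (mrev u + mrev v)%MM.
Proof. by apply/mnmP=> i; rewrite !(mrevE, mnmDE). Qed.

Lemma mrev0 : mrev 0%MM = 0%MM :> 'X_{1..n}.
Proof. by apply/mnmP=> i; rewrite mrevE !mnm0E. Qed.

Lemma mrev1 i : mrev U_(i)%MM = U_(rev_ord i)%MM :> 'X_{1..n}.
Proof.
by apply/mnmP=> j; rewrite mrevE !mnm1E -(inj_eq rev_ord_inj) rev_ordK.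
Qed.

Lemma mdeg_mrev u : mdeg (mrev u) = mdeg u.
Proof.
rewrite !mdegE (reindex_inj rev_ord_inj); apply: eq_bigr => i _.
by rewrite mrevE rev_ordK.
Qed.

Definition separated u := forall i, u i = 0%N \/ u (rev_ord i) = 0%N.

(** Two vectors whose symmetrizations agree differ by an antisymmetric vector;
    the reversal exchanges the positive and the negative part of the latter. *)
Lemma symmetrization_split u v : (u + mrev u = v + mrev v)%MM ->
  exists k a, [/\ u = (k + a)%MM, v = (k + mrev a)%MM & separated a].
Proof.
move=> uv; have e i : (u i + u (rev_ord i) = v i + v (rev_ord i))%N.
  by have := congr1 (fun m : 'X_{1..n} => m i) uv; rewrite !mnmDE !mrevE.
exists (u - (u - v))%MM, (u - v)%MM; split.
- by apply/mnmP=> i; rewrite mnmDE !mnmBE; lia.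
- by apply/mnmP=> i; rewrite mnmDE mrevE !mnmBE; have := e i; lia.
- by move=> i; rewrite !mnmBE; have := e i; lia.
Qed.

End Reversal.

Section Weight.
Variables (l : nat) (c : 'M[int]_(l, 2)).
Implicit Types u v : 'X_{1..l + l}.

Definition weight u : int :=
  \sum_j (matA c ord0 j - matA c ord_max j) * (u j)%:Z.

Lemma weightD u v : weight (u + v) = weight u + weight v.
Proof.
rewrite -big_split; apply: eq_bigr => j _.
by rewrite mnmDE PoszD mulrDr.
Qed.

Lemma weight1 j : weight U_(j) = matA c ord0 j - matA c ord_max j.
Proof.
rewrite /weight (bigD1 j) //= mnm1E eqxx mulr1 big1 ?addr0 // => i ij.
by rewrite mnm1E eq_sym (negPf ij) mulr0.
Qed.

Lemma rev_ord_lshift (i : 'I_l) : rev_ord (lshift l i) = rshift l (rev_ord i).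
Proof. by apply: val_inj; rewrite /= addnBA. Qed.

Lemma matA_lshift r i : matA c r (lshift l i) = c i r.
Proof. by rewrite mxE (unsplitK (inl i)). Qed.

Lemma matA_rev r j : matA c r (rev_ord j) = matA c (rev_ord r) j.
Proof.
rewrite -(splitK j); case: (split j) => i /=.
  by rewrite rev_ord_lshift !mxE (unsplitK (inr _)) (unsplitK (inl _)) rev_ordK.
rewrite -(rev_ordK i) -rev_ord_lshift rev_ordK rev_ord_lshift !mxE.
by rewrite (unsplitK (inr _)) (unsplitK (inl _)) !rev_ordK.
Qed.

Lemma rev_ord0_2 : rev_ord (@ord0 1) = ord_max.
Proof. exact: val_inj. Qed.

Lemma rev_ord_max2 : rev_ord (@ord_max 1) = ord0.
Proof. exact: val_inj. Qed.

Lemma weight_mrev u : weight (mrev u) = - weight u.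
Proof.
rewrite /weight (reindex_inj rev_ord_inj) -sumrN; apply: eq_bigr => j _.
by rewrite mrevE rev_ordK !matA_rev rev_ord_max2 rev_ord0_2 -mulNr opprB.
Qed.

(** The two entries of the product of the matrix and [u] differ by [weight u].
    Their sum is a combination of the column sums of the matrix, which are
    nonnegative as the vectors [pair_vec i] are in the monoid; so if the two
    entries are equal, they are nonnegative. *)
Lemma monA_weight (hpair : forall i, monA c (pair_vec i)) u :
  monA c u <-> weight u = 0.
Proof.
pose row r v := \sum_j matA c r j * (v j : nat)%:Z.
have rowE r v k : (matA c *m \col_j (v j)%:Z) r k = row r v.
  by rewrite mxE; apply: eq_bigr => j _; congr (_ * _); rewrite mxE.
have weightE v : weight v = row ord0 v - row ord_max v.
  by rewrite /weight /row -sumrB; apply: eq_bigr => j _; rewrite mulrBl.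
split=> [[k e]|w0].
  by rewrite weightE -!(rowE _ _ ord0) e !mxE subrr.
have col_ge0 j : 0 <= matA c ord0 j + matA c ord_max j.
  have left i : 0 <= matA c ord0 (lshift l i) + matA c ord_max (lshift l i).
    have [k e] := hpair i.
    have := congr1 (fun M : 'cV_2 => M ord0 ord0) e; rewrite rowE mxE /row.
    rewrite (bigD1 (lshift l i)) //= (bigD1 (rev_ord (lshift l i))) /=; last first.
      by rewrite rev_ord_lshift eq_sym eq_lrshift.
    rewrite !mnmDE !mnm1E !eqxx rev_ord_lshift eq_lrshift eq_rlshift /=.
    rewrite big1 => [|t /andP[tl tr]].
      rewrite -rev_ord_lshift matA_rev addn0 add0n !mulr1 addr0.
      by rewrite rev_ord0_2 => ->.
    by rewrite mnmDE !mnm1E rev_ord_lshift ![_ == t]eq_sym (negPf tl) (negPf tr) mulr0.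
  rewrite -(splitK j); case: (split j) => i /=; first exact: left.
  rewrite -(rev_ordK i) -rev_ord_lshift !matA_rev rev_ord0_2 rev_ord_max2.
  by rewrite addrC; apply: left.
have row_eq : row ord0 u = row ord_max u.
  by apply/eqP; rewrite -subr_eq0 -weightE w0.
have row_ge0 : 0 <= row ord0 u.
  have : 0 <= row ord0 u + row ord_max u.
    rewrite /row -big_split /=; apply: sumr_ge0 => j _.
    by rewrite -mulrDl mulr_ge0.
  by rewrite -row_eq; lia.
exists `|row ord0 u|%N; apply/matrixP=> r k.
rewrite rowE mxE gez0_abs //.
by case: r => [[|[|r]] hr] //; [|rewrite row_eq]; congr (row _ u); apply: val_inj.
Qed.

End Weight.

(** * Generating sets and irreducible elements *)

Section Irreducible.
Variable n : nat.
Implicit Types (M S : 'X_{1..n} -> Prop) (m : 'X_{1..n}).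

Definition irreducible M m : Prop :=
  m != 0%MM /\ forall u v, M u -> M v -> m = (u + v)%MM -> u = 0%MM \/ v = 0%MM.

Lemma generates_irreducible M S m :
  generates S M -> M m -> irreducible M m -> S m.
Proof.
move=> gen /gen[s [sS e]] [m0 irr]; elim: s sS e => [|x s IHs] sS.
  by rewrite big_nil => e; rewrite e eqxx in m0.
have Sx : S x by apply: sS; rewrite mem_head.
have sS' y : y \in s -> S y by move=> sy; apply: sS; rewrite inE sy orbT.
rewrite big_cons => e.
have Mx : M x.
  by apply/gen; exists [:: x]; rewrite big_seq1; split=> // y; rewrite inE => /eqP->.
have Ms : M (\sum_(y <- s) y)%MM by apply/gen; exists s.
case: (irr _ _ Mx Ms e) => e0; move: e; rewrite e0.
  by rewrite add0m; apply: IHs.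
by rewrite addm0 => ->.
Qed.

Lemma hilbert_basis_irreducible M S :
  finite_subset S -> generates S M -> (forall m, S m -> irreducible M m) ->
  hilbert_basis M S.
Proof.
move=> fin gen irr; split=> // S' _ gen' m Sm.
apply: (generates_irreducible gen' _ (irr _ Sm)).
apply/gen; exists [:: m]; rewrite big_seq1; split=> // y.
by rewrite inE => /eqP ->.
Qed.

End Irreducible.

(** * The binomial ideal and its reduced Groebner basis *)

Section BinomialIdeal.
Variables (K : fieldType) (l : nat) (c : 'M[int]_(l, 2)).
Hypothesis hpair : forall i, monA c (pair_vec i).
Implicit Types (u v m : 'X_{1..l + l}).

Lemma monA_mrev u : monA c u -> monA c (mrev u).
Proof. by rewrite !(monA_weight hpair) weight_mrev => ->. Qed.

Lemma monAD u v : monA c u -> monA c v -> monA c (u + v)%MM.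
Proof. by rewrite !(monA_weight hpair) weightD => -> ->. Qed.

Lemma monA_cancel u v : monA c u -> monA c (u + v)%MM -> monA c v.
Proof. by rewrite !(monA_weight hpair) weightD => ->; rewrite add0r. Qed.

Lemma monA0 : monA c 0%MM.
Proof.
by apply/(monA_weight hpair)/big1 => j _; rewrite mnm0E mulr0.
Qed.

Lemma monA_sum (s : seq 'X_{1..l + l}) :
  (forall u, u \in s -> monA c u) -> monA c (\sum_(u <- s) u)%MM.
Proof.
by move=> sM; rewrite big_seq; apply: big_ind; [exact: monA0 | exact: monAD |].
Qed.

(** The binomial of a sum is a combination of the binomials of the summands, so
    generators of the monoid give generators of the ideal. *)
Lemma binom_ideal_generates (S : 'X_{1..l + l} -> Prop) (p : {mpoly K[l + l]}) :
  generates S (monA c) -> binom_ideal (monA c) p <-> binom_ideal S p.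
Proof.
move=> gen; split; apply: ideal_gen_le => _ [u Su ->]; last first.
  apply: ideal_gen_sub; exists u => //; apply/gen; exists [:: u].
  by rewrite big_seq1; split=> // y; rewrite inE => /eqP ->.
have [s [sS ->]] := iffLR (gen u) Su.
elim: s sS => [|x s IHs] sS.
  by rewrite big_nil /binom mrev0 subrr; apply: ideal_gen0.
rewrite big_cons; set v := bigop _ _ _.
have -> : binom K (x + v) = 'X_[x] * binom K v + 'X_[mrev v] * binom K x.
  rewrite /binom mrevD !mpolyXD !mulrBr (mulrC 'X_[mrev v]) addrA subrK.
  by rewrite (mulrC 'X_[mrev v]).
apply/ideal_genD; apply/ideal_genM; first apply: IHs => y sy.
  by apply: sS; rewrite inE sy orbT.
by apply: ideal_gen_sub; exists x => //; apply: sS; rewrite mem_head.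
Qed.

(** The monomials with a given value of this map form a coset of the lattice
    spanned by the differences [u - mrev u] for [u] in the monoid. *)
Definition coset u : 'X_{1..l + l} * int := ((u + mrev u)%MM, weight c u).

Lemma coset_add m u v : coset u = coset v -> coset (m + u) = coset (m + v).
Proof.
move=> uv; have e := congr1 fst uv; have w : weight c u = _ := congr1 snd uv.
rewrite /coset !weightD w; congr (_, _).
apply/mnmP=> i; have := congr1 (fun x : 'X_{1..l + l} => x i) e.
by rewrite !mnmDE !mrevE !mnmDE; lia.
Qed.

Lemma coset_mrev u : monA c u -> coset (mrev u) = coset u.
Proof.
rewrite (monA_weight hpair) => w.
by rewrite /coset mrevK addmC weight_mrev w oppr0.
Qed.

Lemma coset_split u v : coset u = coset v ->
  exists k a, [/\ u = (k + a)%MM, v = (k + mrev a)%MM, separated a & monA c a].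
Proof.
move=> uv; have w : weight c u = weight c v := congr1 snd uv.
have [k [a [eu ev sep]]] := symmetrization_split (congr1 fst uv).
exists k, a; split=> //; apply/(monA_weight hpair).
by move: w; rewrite eu ev !weightD weight_mrev; lia.
Qed.

Lemma binom_ideal_diff u v : coset u = coset v ->
  binom_ideal (monA c) ('X_[u] - 'X_[v] : {mpoly K[l + l]}).
Proof.
move=> /coset_split[k [a [-> -> _ Ma]]].
rewrite !mpolyXD -mulrBr; apply/ideal_genM/ideal_gen_sub.
by exists a.
Qed.

Lemma binom_ideal_fiber_sum (p : {mpoly K[l + l]}) t :
  binom_ideal (monA c) p -> fiber_sum coset t p = 0.
Proof.
apply: fiber_sum_ideal; first exact: coset_add.
move=> _ [u Mu ->]; exists u, (mrev u); by rewrite coset_mrev.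
Qed.

Variables (le : rel 'X_{1..l + l}) (G : seq {mpoly K[l + l]}).
Hypotheses (hle : term_order le)
  (hG : reduced_groebner_basis le (binom_ideal (monA c)) G).

(** An element of [G] is a difference of two monomials of the same coset, say
    of [k + a] and [k + mrev a]. The binomial of [a] is also in the ideal, and
    its leading monomial divides that of the element of [G]; reducedness leaves
    only [k = 0]. *)
Lemma groebner_binom g : g \in G -> exists a,
  [/\ monA c a, a != mrev a, separated a, g = binom K a & lead_monomial le g a].
Proof.
move=> Gg.
have [a0 [b0 [neq P eg ga]]] :=
  reduced_binomial hle hG binom_ideal_diff binom_ideal_fiber_sum Gg.
have [k [a [ea eb sep Ma]]] := coset_split P.
have aa : a != mrev a by apply: contraNneq neq => e; rewrite ea eb -e.
have gb : b0 \in msupp g by rewrite eg mem_msupp_diff // eqxx orbT.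
have led : lead_monomial le (binom K a) a.
  apply: lead_monomial_diff => //; apply: (term_order_addr hle (m := k)).
  by rewrite ![(_ + k)%MM]addmC -ea -eb; case: ga => _; apply.
have Ia : binom_ideal (monA c) (binom K a) by apply: ideal_gen_sub; exists a.
have dvd : (a0 <= a)%MM.
  apply: (reduced_lead_min hle hG Ia led Gg ga (proj1 ga)).
  by rewrite ea lem_addl.
have k0 : k = 0%MM.
  apply/mnmP=> i; rewrite mnm0E; have := mnm_lepP dvd i.
  by rewrite ea mnmDE; lia.
by rewrite ea eb k0 !add0m in eg ga; exists a.
Qed.

(** The support of a nonzero binomial determines its exponent up to reversal, so
    what [groebner_binom] gives for one exponent holds for all of them, whatever
    the sign of the binomial. *)
Lemma groebner_exponent u : binom K u \in G ->
  [/\ u \in msupp (binom K u), mrev u \in msupp (binom K u) &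
    exists2 a, [/\ monA c a, a != mrev a, separated a, binom K a \in G
      & lead_monomial le (binom K a) a] & u = a \/ u = mrev a].
Proof.
move=> Gu; have [a [Ma aa sep e ga]] := groebner_binom Gu.
have uu : u != mrev u.
  apply: contraTneq (proj1 ga) => uu.
  by rewrite /binom -uu subrr msupp0.
have memu : u \in msupp (binom K u) by rewrite mem_msupp_diff // eqxx.
split=> //; first by rewrite mem_msupp_diff // eqxx orbT.
exists a; first by rewrite -e.
by move: memu; rewrite e mem_msupp_diff // => /orP[]/eqP; auto.
Qed.

Lemma setH_monA u : setH G u -> monA c u.
Proof.
case=> [[m Gm um]|[i ->]]; last exact: hpair.
have [_ _ [a [Ma _ _ _ _] ma]] := groebner_exponent Gm.
by case: um ma => -> [] ->; rewrite ?mrevK //; apply: monA_mrev.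
Qed.

Lemma setH_mrev u : setH G u -> setH G (mrev u).
Proof.
case=> [[m Gm um]|[i ->]]; last first.
  right; exists i; rewrite mrevD !mrev1 rev_ordK; exact: addmC.
by left; exists m => //; case: um => ->; rewrite ?mrevK; auto.
Qed.

Lemma setH_finite : finite_subset (setH G).
Proof.
exists (flatten [seq msupp g | g <- G] ++ [seq pair_vec i | i <- enum 'I_l]).
move=> u [[m Gm um]|[i ->]]; rewrite mem_cat; apply/orP; [left|right].
  apply/flattenP; exists (msupp (binom K m)); first exact: map_f.
  by have [mm rm _] := groebner_exponent Gm; case: um => ->.
by rewrite map_f ?mem_enum.
Qed.

Lemma pair_vec_dvd u i : u i != 0%N -> u (rev_ord i) != 0%N ->
  exists j : 'I_l, (pair_vec j <= u)%MM.
Proof.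
move=> ui uri.
have main (j : 'I_l) : u (lshift l j) != 0%N -> u (rev_ord (lshift l j)) != 0%N ->
    (pair_vec j <= u)%MM.
  move=> uj urj; apply/mnm_lepP=> k; rewrite mnmDE !mnm1E.
  have neq : lshift l j != rev_ord (lshift l j).
    by rewrite rev_ord_lshift eq_lrshift.
  have [<-|jk] := eqVneq (lshift l j) k.
    by rewrite eq_sym (negPf neq) addn0 lt0n.
  by case: eqP => [<-|//]; rewrite add0n lt0n.
move: ui uri; rewrite -(splitK i); case: (split i) => j /= ui uri.
  by exists j; apply: main.
have e : rshift l j = rev_ord (lshift l (rev_ord j)).
  by rewrite rev_ord_lshift rev_ordK.
by exists (rev_ord j); apply: main; rewrite -?e //; move: uri; rewrite e rev_ordK.
Qed.

(** If [u] meets its reversal then some [pair_vec j] divides it. Otherwise the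
    binomial of [u] is a nonzero element of the ideal, and the leading monomial
    of an element of [G] divides [u] or its reversal. *)
Lemma setH_dvd u : monA c u -> u != 0%MM ->
  exists v, [/\ setH G v, v != 0%MM & (v <= u)%MM].
Proof.
move=> Mu u0.
have [/existsP[i /andP[ui uri]]|/existsPn sep] :=
    boolP [exists i, (u i != 0%N) && (u (rev_ord i) != 0%N)].
  have [j ju] := pair_vec_dvd ui uri; exists (pair_vec j); split=> //.
    by right; exists j.
  by rewrite mnmD_eq0 mnm1_eq0.
have uu : u != mrev u.
  apply: contraNneq u0 => e; apply/eqP/mnmP=> i; rewrite mnm0E.
  have := sep i; have := congr1 (fun m : 'X_{1..l + l} => m i) e.
  by rewrite mrevE => <-; rewrite andbb negbK => /eqP.
have main v : monA c v -> v != mrev v -> le (mrev v) v ->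
    exists w, [/\ setH G w, w != 0%MM & (w <= v)%MM].
  move=> Mv vv rv.
  have Iv : binom_ideal (monA c) (binom K v) by apply: ideal_gen_sub; exists v.
  have [g [a0 [Gg ga av]]] :=
    groebner_lead_dvd hG Iv (lead_monomial_diff hle K vv rv).
  have [a [_ aa _ eg ga']] := groebner_binom Gg.
  rewrite (lead_monomial_uniq hle ga ga') in av; exists a; split=> //.
    by left; exists a; rewrite -?eg; auto.
  by apply: contraNneq aa => ->; rewrite mrev0.
case: (term_order_total hle (mrev u) u) => h; first exact: main.
have [|||w [Hw w0 wu]] := main (mrev u); rewrite ?mrevK //.
- exact: monA_mrev.
- by rewrite eq_sym.
exists (mrev w); split; first exact: setH_mrev.
  by apply: contraNneq w0 => e; rewrite -(mrevK w) e mrev0.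
by apply/mnm_lepP=> i; have := mnm_lepP wu (rev_ord i); rewrite !mrevE rev_ordK.
Qed.

(** The monoid is saturated: the difference of one of its elements and a smaller
    one belongs to it. So a divisor in [setH G] can be split off each nonzero
    element, and the degree decreases. *)
Lemma setH_generates : generates (setH G) (monA c).
Proof.
move=> u; split=> [|[s [sS ->]]]; last first.
  by apply: monA_sum => x /sS; apply: setH_monA.
have [k] := ubnP (mdeg u); elim: k u => // k IHk u deg_u Mu.
have [->|u0] := eqVneq u 0%MM; first by exists [::]; rewrite big_nil.
have [v [Hv v0 vu]] := setH_dvd Mu u0.
have e : u = (v + (u - v))%MM by rewrite addmC submK.
have [||s [sS es]] := IHk (u - v)%MM.
- move: deg_u; rewrite {1}e mdegD.
  by move: v0; rewrite -mdeg_eq0; lia.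
- by apply: (monA_cancel (setH_monA Hv)); rewrite -e.
exists (v :: s); rewrite big_cons -es -e; split=> // x.
by rewrite inE => /orP[/eqP->|/sS].
Qed.

(** Suppose [a = u + v]. One of [u] and [mrev u] is a leading monomial of the
    ideal, and it divides one of the two monomials [a] and [mrev a] of an
    element of [G]; hence it is divisible by the leading monomial [a] of that
    element. Comparing degrees, [v = 0]. *)
Lemma groebner_irreducible a : binom K a \in G -> lead_monomial le (binom K a) a ->
  a != mrev a -> separated a -> irreducible (monA c) a.
Proof.
move=> Ga ga aa sep; split; first by apply: contraNneq aa => ->; rewrite mrev0.
move=> u v Mu Mv e; have [->|u0] := eqVneq u 0%MM; [by left | right].
have uu : u != mrev u.
  apply: contraNneq u0 => eu; apply/eqP/mnmP=> i; rewrite mnm0E.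
  have := congr1 (fun m : 'X_{1..l + l} => m i) eu; rewrite mrevE.
  by have := sep i; rewrite e !mnmDE; lia.
have main w b : monA c w -> w != mrev w -> le (mrev w) w ->
    b \in msupp (binom K a) -> (w <= b)%MM -> (a <= w)%MM.
  move=> Mw ww rw; apply: (reduced_lead_min hle hG _ _ Ga ga).
    by apply: ideal_gen_sub; exists w.
  exact: lead_monomial_diff.
have finish w : mdeg w = mdeg u -> (a <= w)%MM -> v = 0%MM.
  move=> dw /submK/(congr1 (@mdeg _)); rewrite e !mdegD dw => d.
  by apply/eqP; rewrite -mdeg_eq0; lia.
case: (term_order_total hle (mrev u) u) => h.
  apply: (finish u erefl); apply: (main u a) => //; first exact: (proj1 ga).
  by rewrite e lem_addr.
apply: (finish (mrev u)); first exact: mdeg_mrev.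
apply: (main _ (mrev a)); rewrite ?mrevK //.
- exact: monA_mrev.
- by rewrite eq_sym.
- by rewrite mem_msupp_diff // eqxx orbT.
- by rewrite e mrevD lem_addr.
Qed.

Lemma irreducible_mrev u :
  irreducible (monA c) u -> irreducible (monA c) (mrev u).
Proof.
case=> u0 irr; split; first by apply: contraNneq u0 => e; rewrite -(mrevK u) e mrev0.
move=> v w Mv Mw /(congr1 (@mrev _)); rewrite mrevK mrevD.
case/(irr _ _ (monA_mrev Mv) (monA_mrev Mw)) => /(congr1 (@mrev _));
  by rewrite mrevK mrev0; auto.
Qed.

(** A nontrivial summand of [pair_vec i] is a basis vector, whose weight is
    the difference of the two entries of row [i] up to sign. *)
Lemma pair_vec_irreducible i : c i ord0 <> c i ord_max ->
  irreducible (monA c) (pair_vec i).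
Proof.
move=> ci; split; first by rewrite mnmD_eq0 mnm1_eq0.
move=> u v Mu _ e; have [->|u0] := eqVneq u 0%MM; [by left | right].
apply/eqP; apply: contraT => v0; case: ci.
have : mdeg u == 1%N.
  have := congr1 (@mdeg _) e; rewrite !mdegD !mdeg1.
  by move: u0 v0; rewrite -!mdeg_eq0; lia.
case/mdeg1P => j /eqP uj.
have : (0 < pair_vec i j)%N by rewrite e uj mnmDE mnm1E eqxx.
have := iffLR (monA_weight hpair u) Mu.
rewrite uj weight1 mnmDE !mnm1E.
case: eqP => [<-|_]; first by rewrite !matA_lshift => /eqP; rewrite subr_eq0 => /eqP.
case: eqP => [<-|//]; rewrite !matA_rev rev_ord0_2 rev_ord_max2 !matA_lshift.
by move/eqP; rewrite subr_eq0 => /eqP.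
Qed.

Lemma setH_irreducible u : (forall i, c i ord0 <> c i ord_max) ->
  setH G u -> irreducible (monA c) u.
Proof.
move=> ci [[m Gm um]|[i ->]]; last exact: pair_vec_irreducible.
have [_ _ [a [_ aa sep Ga ga] ma]] := groebner_exponent Gm.
have irr := groebner_irreducible Ga ga aa sep.
by case: um ma => -> [] ->; rewrite ?mrevK //; apply: irreducible_mrev.
Qed.

End BinomialIdeal.

(** * Hilbert basis and generators of the ideal *)

Theorem theorem5 (R : realType) (l : nat) (hl : (1 <= l)%N)
    (c : 'M[int]_(l, 2))
    (hpair : forall i : 'I_l, monA c (pair_vec i))
    (le : rel 'X_{1..l + l}) (hle : term_order le)
    (G : seq {mpoly R[i][l + l]})
    (hG : reduced_groebner_basis le (binom_ideal (monA c)) G) :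
  [/\ finite_subset (setH G) /\ generates (setH G) (monA c),
      (forall i : 'I_l, c i ord0 <> c i ord_max) ->
        hilbert_basis (monA c) (setH G)
    & forall p : {mpoly R[i][l + l]},
        binom_ideal (monA c) p <-> binom_ideal (setH G) p].
Proof.
have fin := setH_finite hpair hle hG.
have gen := setH_generates hpair hle hG.
split=> // [ci|p]; last exact: binom_ideal_generates.
by apply: hilbert_basis_irreducible => // u; apply: (setH_irreducible hpair hle hG).
Qed.
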